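(* Let $V$ be a vector space of dimension $n\ge 2$ over the finite field $\mathbb{F}_q$, let $G_0\le\mathrm{GL}(V)$ act transitively on $V\setminus\{0\}$, and let $G=V\rtimes G_0$ act on $V$ by $(v,g)\cdot w=v+g(w)$. Let $W<V$ be a (linear) hyperplane, $S=\{g\in G_0: g(W)=W\}$, $H=WS=\{(w,s): w\in W, s\in S\}$, $K=VS=\{(v,s):v\in V,s\in S\}$, and $L=\{g\in G: g(0)\in W\}$. Then for any $k\in K\setminus H$, the set $M=(L\setminus H)\cup kH$ is a non-canonical $(G,V)$-Cameron-Liebler set of parameter $q^{n-1}$.
   Context: For $a,b\in V$ the star is $G_{a\to b}=\{g\in G: g\cdot a=b\}$ with indicator vector $\mathbf{v}_{a,b}$ (indexed by $G$). A $(G,V)$-Cameron-Liebler (CL) set is a subset of $G$ whose indicator vector is a linear combination of the $\mathbf{v}_{a,b}$; its parameter is $|M|\,|V|/|G|$. A CL set is canonical if it is a star or a union of pairwise disjoint stars, and non-canonical otherwise. $kH=\{kh:h\in H\}$.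
   Formalization: For n = q = 2 the set M is the disjoint union of the two stars taking the nonzero vector of W to the vectors outside W, hence canonical; so non-canonicity is claimed only for (n,q) ≠ (2,2), while the Cameron-Liebler property and the parameter are claimed in all cases. *)

(* Defs.v *)
From HB Require Import structures.
From mathcomp Require Import all_boot all_order all_fingroup all_algebra.
From mathcomp Require Import all_field.

Set Implicit Arguments.
Unset Strict Implicit.
Unset Printing Implicit Defensive.

Import GRing.Theory Num.Theory.
Local Open Scope ring_scope.

(** * Cameron-Liebler sets of a finite group G acting (on the left) on T *)

Section CameronLiebler.

Variables (gT : finGroupType) (T : finType) (act : gT -> T -> T).
Implicit Types (G M : {set gT}).

Definition star G (a b : T) : {set gT} := [set g in G | act g a == b].

(* The vectors are indexed by G, hence the equation is required on G only. *)
Definition is_CL (C : numFieldType) G M : Prop :=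
  M \subset G /\
  exists c : T -> T -> C, forall g, g \in G ->
    (g \in M)%:R = \sum_a \sum_b c a b * (g \in star G a b)%:R.

Definition CL_parameter G M : rat := (#|M| * #|T|)%:R / #|G|%:R.

Definition is_star G M : Prop := exists a b, M = star G a b.

Definition disjoint_union_of_stars G M : Prop :=
  exists P : {set {set gT}},
    [/\ forall A, A \in P -> is_star G A, trivIset P & cover P = M].

(* If #|F| = 2, dim V = 2 and W = {0, w}, then the set (L \ H) u kH is the
   disjoint union of the two stars taking w to a vector outside W, so it is
   canonical; its non-canonicity is asserted in all other cases only. *)
Definition canonical_CL (C : numFieldType) G M : Prop :=
  is_CL C G M /\ (is_star G M \/ disjoint_union_of_stars G M).

End CameronLiebler.

(** * The general linear group of V, with composition as product *)

Section GL.

Variables (F : finFieldType) (V : vectType F).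

Record gl : predArgType :=
  Gl { gl_fun : finvect_type 'End(V); gl_inj : lker gl_fun == 0%VS }.

HB.instance Definition _ := [isSub for gl_fun].
HB.instance Definition _ := [Finite of gl by <:].

Definition gl_lfun (g : gl) : 'End(V) := gl_fun g.

Lemma gl_one_inj : lker (\1%VF : 'End(V)) == 0%VS.
Proof. by apply/lker0P=> x y; rewrite !id_lfunE. Qed.

Lemma gl_mul_inj (f g : gl) : lker (gl_lfun f \o gl_lfun g)%VF == 0%VS.
Proof.
apply/lker0P=> x y; rewrite !comp_lfunE => e.
by apply: (lker0P (gl_inj g)); apply: (lker0P (gl_inj f)).
Qed.

Lemma gl_inv_inj (g : gl) : lker (gl_lfun g)^-1%VF == 0%VS.
Proof.
by apply/lker0P; apply: (can_inj (g := gl_lfun g)); apply: lker0_lfunVK (gl_inj g).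
Qed.

Definition gl_one := @Gl \1%VF gl_one_inj.
Definition gl_mul f g := Gl (gl_mul_inj f g).
Definition gl_inv g := Gl (gl_inv_inj g).

Lemma gl_mulA : associative gl_mul.
Proof. by move=> f g h; apply: val_inj; apply: comp_lfunA. Qed.

Lemma gl_mul1 : left_id gl_one gl_mul.
Proof. by move=> g; apply: val_inj; apply: comp_lfun1l. Qed.

Lemma gl_mulV : left_inverse gl_one gl_inv gl_mul.
Proof. by move=> g; apply: val_inj; apply: lker0_compVf (gl_inj g). Qed.

HB.instance Definition _ := Finite_isGroup.Build gl gl_mulA gl_mul1 gl_mulV.

End GL.

Coercion gl_lfun : gl >-> hom.

(** * The affine group V ><| GL(V), with (v, g) (w, h) = (v + g w, g h) *)

Section Affine.

Variables (F : finFieldType) (V : vectType F).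

(* [finvect_type V] is V equipped with the finite type structure it has as
   a finite-dimensional space over a finite field. *)
Record aff : predArgType := Aff { trans : finvect_type V; lin : gl V }.

Definition aff_pair (x : aff) := (trans x, lin x).
Definition pair_aff (p : finvect_type V * gl V) := Aff p.1 p.2.

Lemma aff_pairK : cancel aff_pair pair_aff.
Proof. by case. Qed.

HB.instance Definition _ := Finite.copy aff (can_type aff_pairK).

Definition aff_act (x : aff) (w : finvect_type V) : finvect_type V :=
  trans x + lin x w.

Definition aff_one := Aff 0 1%g.
Definition aff_mul x y := Aff (aff_act x (trans y)) (lin x * lin y)%g.
Definition aff_inv x := Aff (- (lin x)^-1%g (trans x)) (lin x)^-1%g.

Lemma gl1E (w : V) : (1%g : gl V) w = w.
Proof. exact: id_lfunE. Qed.

Lemma glME (f g : gl V) (w : V) : (f * g)%g w = f (g w).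
Proof. exact: comp_lfunE. Qed.

Lemma aff_mulA : associative aff_mul.
Proof.
move=> [u f] [v g] [w h]; rewrite /aff_mul /aff_act /= mulgA.
by rewrite linearD glME addrA.
Qed.

Lemma aff_mul1 : left_id aff_one aff_mul.
Proof. by case=> v g; rewrite /aff_mul /aff_act /= mul1g gl1E add0r. Qed.

Lemma aff_mulV : left_inverse aff_one aff_inv aff_mul.
Proof. by case=> v g; rewrite /aff_mul /aff_act /= mulVg addNr. Qed.

HB.instance Definition _ := Finite_isGroup.Build aff aff_mulA aff_mul1 aff_mulV.

Lemma aff_act1 w : aff_act 1%g w = w.
Proof. by rewrite /aff_act /= gl1E add0r. Qed.

Lemma aff_actM x y w : aff_act (x * y)%g w = aff_act x (aff_act y w).
Proof. by rewrite /aff_act /= linearD glME addrA. Qed.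

Definition transitive_nonzero (A : {set gl V}) : Prop :=
  forall v w : V, v != 0 -> w != 0 -> exists2 g, g \in A & g v = w.

Definition stab_vs (A : {set gl V}) (W : {vspace V}) : {set gl V} :=
  [set g in A | (gl_lfun g @: W)%VS == W].

(* W S = {(w, s) : w in W, s in S}, as a subset of V ><| GL(V) *)
Definition aff_set (W : {vspace V}) (S : {set gl V}) : {set aff} :=
  [set x | ((trans x : V) \in W) && (lin x \in S)].

Lemma aff_set_group_set (S : {group gl V}) : group_set (aff_set fullv S).
Proof.
apply/group_setP; split=> [|x y]; first by rewrite inE memvf group1.
by rewrite !inE !memvf /= => xS yS; rewrite groupM.
Qed.

Canonical aff_set_group (S : {group gl V}) := Group (aff_set_group_set S).

End Affine.

(* Main.v *)
(* Write k = (v, s). For g in G the hyperplanes g(W) and W, v + W either are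
   parallel, or g(W) meets W and v + W in equally many points; hence the
   difference of the indicators of kH and H is, up to the factor |W|, the sum of
   the stars a -> b (a in W, b in v + W) minus that of the stars a -> b (a, b in
   W). Adding the stars 0 -> b, b in W, whose union is L, gives M, and
   |M| = |L| since kH is disjoint from L.
   M is not a union of stars because no star containing k lies in M: k x maps a
   to k a whenever x fixes a, and k x is outside M as soon as the linear part g
   of x moves W and a - g a avoids a certain coset c + W other than W. If a is
   nonzero, pick B in G0 moving W; as (n, q) <> (2, 2), there is a nonzero u
   avoiding two given cosets of W and B W, and if g a = u then g or B^-1 g is
   as wanted. *)
Require Import Defs.
From mathcomp Require Import all_boot all_order all_fingroup all_algebra.
From mathcomp Require Import all_field.

Set Implicit Arguments.
Unset Strict Implicit.
Unset Printing Implicit Defensive.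

Import GRing.Theory Num.Theory.
Local Open Scope ring_scope.

(** * Vectors avoiding cosets of hyperplanes *)

Section LinearAlgebra.

Variables (F : finFieldType) (V : vectType F).
Implicit Types (U W : {vspace V}).

Lemma memvB_lr U x y z : z \in U -> (x + z - y \in U) = (x - y \in U).
Proof. by move=> zU; rewrite addrAC rpredDr. Qed.

(** If two different scalars put [b *: w - p] in [U], subtracting gives a nonzero multiple of [w] in
    [U]. *)
Lemma line_avoids_coset U (w p : V) :
  w \notin U -> exists b0 : F, forall b, b != b0 -> b *: w - p \notin U.
Proof.
move=> wU; case: (pickP (fun b : F => b *: w - p \in U)) => [b0 b0P|noP].
  exists b0 => b nbb0; apply: contra wU => bP.
  have := rpredB bP b0P; rewrite opprB addrA subrK -scalerBl.
  by rewrite rpredZeq subr_eq0 (negPf nbb0).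
by exists 0 => b _; rewrite noP.
Qed.

(** Take [w1] in [U] outside [W], [w2] in [W] outside [U], and [u = a *: w1 + b *: w2 + z] with [z]
    in both. Modulo [U] only [b] matters and modulo [W] only [a], so each condition excludes at most
    one scalar. What remains is to make [u] nonzero: by a nonzero [a] if the field has more than two
    elements, by a suitable [z] if [n > 2]. *)
Lemma outside_two_cosets (n : nat) U W (p p' : V) :
  \dim {: V} = n -> (2 <= n)%N -> \dim U = n.-1 -> \dim W = n.-1 ->
  U != W -> (n, #|F|) != (2, 2)%N ->
  exists u, [/\ u != 0, u - p \notin U & u - p' \notin W].
Proof.
move=> dV n2 dU dW neUW nq.
have nsub U1 U2 : \dim U1 = \dim U2 -> U1 != U2 ->
    exists2 w, w \in U1 & w \notin U2.
  move=> e ne; apply/subvPn; apply: contra ne => s.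
  by rewrite eqEdim s e leqnn.
have [w1 w1U w1W] : exists2 w, w \in U & w \notin W.
  by apply: nsub neUW; rewrite dU.
have [w2 w2W w2U] : exists2 w, w \in W & w \notin U.
  by apply: nsub; rewrite 1?eq_sym // dU.
have [a0 a0P] := @line_avoids_coset _ w1 p' w1W.
have [b0 b0P] := @line_avoids_coset _ w2 p w2U.
have cand a b z : a != a0 -> b != b0 -> z \in (U :&: W)%VS ->
    let u := a *: w1 + b *: w2 + z in u - p \notin U /\ u - p' \notin W.
  move=> na nb; rewrite memv_cap => /andP[zU zW] /=.
  split; rewrite memvB_lr //.
    by rewrite (addrC (a *: w1)) memvB_lr ?rpredZ // b0P.
  by rewrite memvB_lr ?rpredZ // a0P.
have other (x y : F) : (2 < #|F|)%N || (x == y) -> exists2 z, z != x & z != y.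
  move=> h; have /subsetPn[z _] : ~~ (F \subset [set x; y]).
    apply/negP => /subset_leq_card; rewrite cards2.
    case: eqVneq h => /= [_ _|_].
      by rewrite leqNgt finNzRing_gt1.
    by rewrite orbF ltnNge => /negPf->.
  by rewrite !inE negb_or => /andP[]; exists z.
have [b nb _] : exists2 z, z != b0 & z != b0 by apply: other; rewrite eqxx orbT.
have [F2|F2] := ltnP 2 #|F|.
  have [|a na na0] := other a0 0; first by rewrite F2.
  have [uU uW] := cand a b 0 na nb (mem0v _).
  eexists; split; [|exact: uU|exact: uW].
  apply: contra w1W => /eqP; rewrite addr0 => /eqP; rewrite addr_eq0 => /eqP e.
  have : a *: w1 \in W by rewrite e rpredN rpredZ.
  by rewrite rpredZeq (negPf na0).
have [a na _] : exists2 z, z != a0 & z != a0 by apply: other; rewrite eqxx orbT.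
have [uU uW] := cand a b 0 na nb (mem0v _).
have [u0|?] := eqVneq (a *: w1 + b *: w2) 0; last first.
  by eexists; split; [|exact: uU|exact: uW]; rewrite addr0.
have F2e : #|F| = 2%N by apply/eqP; rewrite eqn_leq F2 finNzRing_gt1.
have n3 : (2 < n)%N.
  by rewrite ltn_neqAle n2 andbT; apply: contra nq => /eqP<-; rewrite F2e.
(* The intersection has dimension at least [2 * (n - 1) - n = n - 2 > 0]. Since [a *: w1 + b *: w2]
   vanishes here, adding this vector gives a nonzero [u]. *)
have z0 : vpick (U :&: W)%VS != 0.
  rewrite vpick0 -dimv_eq0 -lt0n.
  have := dimv_sum_cap U W; rewrite dU dW => e.
  have := dimvS (subvf (U + W)); rewrite dV => l.
  rewrite -(ltn_add2l (\dim (U + W))) addn0 e (leq_ltn_trans l) //.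
  case: n n3 {dV n2 dU dW nq e l} => [|[|[|m]]] // _.
  by rewrite /= addSn !addnS !ltnS leq_addr.
have [{}uU {}uW] := cand a b _ na nb (memv_pick _).
by eexists; split; [|exact: uU|exact: uW]; rewrite u0 add0r.
Qed.

End LinearAlgebra.

(** * Criteria for Cameron-Liebler and non-canonical sets *)

Section Stars.

Variables (gT : finGroupType) (T : finType) (act : gT -> T -> T).
Variables (C : numFieldType) (G M : {set gT}).

(** For fixed [a], an element [g] of [G] lies in exactly one star from [a], the one to [act g a], so
    the double sum collapses. *)
Lemma CL_of_action (c : T -> T -> C) :
  M \subset G -> (forall g, g \in G -> (g \in M)%:R = \sum_a c a (act g a)) ->
  is_CL act C G M.
Proof.
move=> sMG cM; split=> //; exists c => g gG; rewrite cM //.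
apply: eq_bigr => a _; rewrite (bigD1 (act g a)) //= inE gG eqxx mulr1.
rewrite big1 ?addr0 // => b; rewrite eq_sym inE gG => /negPf->.
by rewrite mulr0.
Qed.

Lemma non_canonical k :
  k \in M -> (forall a, ~~ (star act G a (act k a) \subset M)) ->
  ~ canonical_CL act C G M.
Proof.
move=> kM noM [_ can].
suff [a [b [kab]]] :
    exists a b, k \in star act G a b /\ star act G a b \subset M.
  by move: kab; rewrite inE => /andP[_ /eqP<-]; apply/negP.
case: can => [[a [b e]]|[P [Pstar _ e]]]; first by exists a, b; rewrite -e.
move: kM; rewrite -e => /bigcupP[A AP kA].
have [a [b eA]] := Pstar A AP; exists a, b; rewrite -eA; split=> //.
exact: bigcup_sup.
Qed.

End Stars.

(** * Stabilisers, cardinalities and incidence sums in the affine group *)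

Section AffineGroup.

Variables (F : finFieldType) (V : vectType F).
Implicit Types (U W : {vspace V}) (g : gl V) (v : V).

Lemma glVK g : cancel g (g^-1)%g.
Proof. by move=> v; rewrite -glME mulVg gl1E. Qed.

Lemma glKV g : cancel (g^-1)%g g.
Proof. by move=> v; rewrite -glME mulgV gl1E. Qed.

Lemma dim_gl_img g U : \dim (gl_lfun g @: U) = \dim U.
Proof. by apply: limg_dim_eq; rewrite (eqP (gl_inj g)) capv0. Qed.

Lemma mem_gl_img g U v : (v \in gl_lfun g @: U)%VS = ((g^-1)%g v \in U).
Proof.
apply/memv_imgP/idP => [[u uU ->]|vU]; first by rewrite glVK.
by exists ((g^-1)%g v); rewrite ?glKV.
Qed.

Lemma stab_vsP (A : {group gl V}) W g :
  reflect (g \in A /\ forall v, (g v \in W) = (v \in W)) (g \in stab_vs A W).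
Proof.
rewrite inE; apply: (iffP andP) => -[gA].
  by move/eqP => e; split=> // v; rewrite -{1}e mem_gl_img glVK.
move=> e; split=> //; apply/eqP/vspaceP => v.
by rewrite mem_gl_img -e glKV.
Qed.

Lemma stab_vs_group_set (A : {group gl V}) W : group_set (stab_vs A W).
Proof.
apply/group_setP; split.
  by apply/stab_vsP; split=> // v; rewrite gl1E.
move=> g h /stab_vsP[gA gW] /stab_vsP[hA hW].
by apply/stab_vsP; split=> [|v]; rewrite ?groupM // glME gW.
Qed.

Canonical stab_vs_group (A : {group gl V}) W := Group (stab_vs_group_set A W).

(* The structure that finvect_type rebuilds on V is convertible to that of V
   only once the latter is destructed. *)
Lemma card_vspace_finvect U :
  #|[pred v : finvect_type V | (v : V) \in U]| = (#|F| ^ \dim U)%N.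
Proof.
move: U; case: V => T [*].
match goal with U : {vspace ?vT} |- _ = (_ ^ \dim ?U)%N =>
  exact: (@card_vspace F (finvect_type vT) (Vector.class vT) U) end.
Qed.

Lemma card_aff_set U (A : {set gl V}) :
  #|aff_set U A| = (#|F| ^ \dim U * #|A|)%N.
Proof.
have -> : (#|F| ^ \dim U = #|[set v : finvect_type V | v \in U]|)%N.
  by rewrite -card_vspace_finvect cardsE.
rewrite -cardsX -(card_imset _ (can_inj (@aff_pairK F V))).
apply: eq_card => -[v g]; apply/imsetP/idP => [[x xUA [-> ->]]|].
  by move: xUA; rewrite !inE.
by rewrite !inE /= => vg; exists (Aff v g); rewrite ?inE.
Qed.

Lemma mem_aff_set U (A : {set gl V}) (x : aff V) :
  (x \in aff_set U A) = ((trans x : V) \in U) && (lin x \in A).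
Proof. by rewrite inE. Qed.

Lemma aff_act_fix0 (x : aff V) : aff_act x 0 = trans x.
Proof. by rewrite /aff_act linear0 addr0. Qed.

(* v = u + x w with u and w in W, and a |-> a + w identifies the two sums. *)
Lemma sum_transverse (C : numFieldType) W (x : aff V) (v : V) :
  (\dim W).+1 = \dim {: V} -> (gl_lfun (lin x) @: W)%VS != W ->
  \sum_(a : finvect_type V | (a : V) \in W)
      (((aff_act x a : V) - v \in W)%:R : C) =
  \sum_(a : finvect_type V | (a : V) \in W) ((aff_act x a : V) \in W)%:R.
Proof.
move=> dW nxW.
have /memv_addP[u uW [_ /memv_imgP[w wW ->] ve]] :
    v \in (W + gl_lfun (lin x) @: W)%VS.
  (* A proper subspace containing the hyperplane [W] equals [W], so the image of [W] would lie in
     [W] and, by dimension, be [W]. *)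
  suff /eqP-> : (W + gl_lfun (lin x) @: W == fullv)%VS by apply: memvf.
  rewrite eqEdim subvf -dW ltnNge; apply: contra nxW => le.
  have := dimv_leqif_eq (addvSl W (gl_lfun (lin x) @: W)).
  move/geq_leqif; rewrite le => /esym/eqP e.
  by rewrite eqEdim dim_gl_img leqnn andbT {2}e addvSr.
rewrite (reindex_inj (addIr (w : finvect_type V))) /=.
apply: eq_big => a; first by rewrite rpredDr.
move=> _; congr (_%:R); rewrite ve /aff_act linearD /= opprD.
rewrite [- u - _]addrC addrA addrA addrK.
by rewrite rpredBr.
Qed.

(** Modulo [W], the image of any [a] in [W] is [trans x], so all terms agree. *)
Lemma sum_parallel (C : numFieldType) W (x : aff V) (v : V) :
  (gl_lfun (lin x) @: W)%VS = W ->
  \sum_(a : finvect_type V | (a : V) \in W)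
      (((aff_act x a : V) - v \in W)%:R : C) =
  (#|F| ^ \dim W)%:R * ((trans x : V) - v \in W)%:R.
Proof.
move=> xW; rewrite (eq_bigr (fun=> ((trans x : V) - v \in W)%:R)).
  by rewrite sumr_const -card_vspace_finvect mulr_natl.
move=> a aW; congr (_%:R); rewrite /aff_act memvB_lr //.
by rewrite -[in X in _ \in X]xW memv_img.
Qed.

(** Transitivity takes some nonzero vector of [W] to one outside [W]. *)
Lemma exists_moving (G0 : {group gl V}) W :
  transitive_nonzero G0 -> (0 < \dim W)%N -> (\dim W).+1 = \dim {: V} ->
  exists2 g, g \in G0 & g \notin stab_vs G0 W.
Proof.
move=> tr W0 dW.
have w0 : vpick W != 0 by rewrite vpick0 -dimv_eq0 -lt0n.
have /subvPn[v _ vW] : ~~ (fullv <= W)%VS.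
  by apply/negP => /dimvS; rewrite -dW ltnn.
have v0 : v != 0 by apply: contra vW => /eqP->; apply: mem0v.
have [g gG0 gv] := tr _ _ w0 v0; exists g => //.
by apply/stab_vsP => -[_ /(_ (vpick W))]; rewrite gv memv_pick (negPf vW).
Qed.

Lemma exists_moving_avoiding (G0 : {group gl V}) W (a c : V) :
  transitive_nonzero G0 -> (2 <= \dim {: V})%N -> (\dim W).+1 = \dim {: V} ->
  (\dim {: V}, #|F|) != (2, 2)%N -> c \notin W ->
  exists g, [/\ g \in G0, g \notin stab_vs G0 W & a - g a - c \notin W].
Proof.
move=> tr n2 dW nq cW.
have W0 : (0 < \dim W)%N by rewrite -ltnS dW.
have [B BG0 BS] := exists_moving tr W0 dW.
have [->|a0] := eqVneq a 0.
  by exists B; rewrite linear0 subrr sub0r rpredN.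
(* The first coset is the one that [g a] must avoid; the second is its image under [B], so that the
   inverse of [B] takes [u] off the first coset too. *)
have [||||||u [u0 uW uBW]] :=
  @outside_two_cosets _ V (\dim {: V}) W (gl_lfun B @: W) (a - c) (B (a - c)).
- by [].
- exact: n2.
- by rewrite -dW.
- by rewrite dim_gl_img -dW.
- by rewrite eq_sym; apply: contra BS; rewrite inE BG0.
- exact: nq.
have [A AG0 Aa] := tr _ _ a0 u0.
have flip (y : V) : (a - y - c \in W) = (y - (a - c) \in W).
  by rewrite -rpredN !opprB addrCA.
have [AS|AS] := boolP (A \in stab_vs G0 W); last first.
  by exists A; rewrite Aa flip.
(* B^-1 A cannot also lie in the stabiliser of W, since B does not. *)
exists (B^-1 * A)%g; split; first by rewrite groupM ?groupV.
  by rewrite groupMr // groupV.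
by rewrite glME Aa flip; move: uBW; rewrite mem_gl_img linearB /= glVK.
Qed.

End AffineGroup.

(** * The three properties of [M] *)

Theorem theorem5p1 (C : numFieldType) (q n : nat) (F : finFieldType)
    (V : vectType F) (G0 : {group gl V}) (W : {vspace V}) (k : aff V) :
  #|F| = q -> \dim {: V} = n -> (2 <= n)%N ->
  transitive_nonzero G0 ->
  \dim W = n.-1 ->
  let G := aff_set fullv G0 in
  let S := stab_vs G0 W in
  let H := aff_set W S in
  let K := aff_set fullv S in
  let L := [set g in G | (aff_act g 0 : V) \in W] in
  k \in K :\: H ->
  let M := (L :\: H) :|: (k *: H)%g in
  [/\ is_CL (@aff_act F V) C G M,
      CL_parameter (finvect_type V) G M = (q ^ n.-1)%N%:R
    & ((n, q) != (2%N, 2%N)) -> ~ canonical_CL (@aff_act F V) C G M].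
Proof.
move=> Fq dV n2 tr dW G S H K L kKH M.
have dW1 : (\dim W).+1 = \dim {: V} by rewrite dW dV prednK // ltnW.
have q0 : (0 < q)%N by rewrite -Fq ltnW ?finNzRing_gt1.
have [kS kW] : lin k \in S /\ (trans k : V) \notin W.
  move: kKH; rewrite inE !mem_aff_set memvf /= negb_and => /andP[kH kS].
  by move: kH; rewrite kS orbF.
have kG0 : lin k \in G0 by case/stab_vsP: kS.
have kG : k \in G by rewrite mem_aff_set memvf.
have kSW w : (lin k w \in W) = (w \in W) by case/stab_vsP: kS.
have HE x : (x \in H) = ((trans x : V) \in W) && (lin x \in S).
  exact: mem_aff_set.
have kHE x : (x \in (k *: H)%g) =
    ((trans x : V) - trans k \in W) && (lin x \in S).
  (* With [x = k * y], the difference of translations is [lin k (trans y)], and [lin k] preserves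
     [W]. *)
  have -> : x = (k * (k^-1 * x))%g by rewrite mulKVg.
  rewrite mem_lcoset mulKg HE; move: (k^-1 * x)%g => y.
  rewrite [trans (k * y)%g]/= [lin (k * y)%g]/= groupMl // /aff_act.
  by rewrite addrC addKr kSW.
have LE : L = aff_set W G0.
  by apply/setP => x; rewrite !inE memvf aff_act_fix0 andbC.
have sHL : H \subset L.
  apply/subsetP => x; rewrite HE LE mem_aff_set.
  by case/andP=> -> /stab_vsP[-> _].
have sLG : L \subset G by apply/subsetP => x; rewrite inE => /andP[].
have skHG : (k *: H)%g \subset G.
  apply/subsetP => x; rewrite kHE mem_aff_set memvf.
  by case/andP=> _ /stab_vsP[].
have disj x : x \in (k *: H)%g -> x \notin L.
  rewrite kHE LE mem_aff_set => /andP[xk _]; apply: contra kW => /andP[xW _].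
  by rewrite -(rpredBl _ xW).
have sMG : M \subset G by rewrite subUset skHG (subset_trans (subsetDl _ _)).
have cardM : #|M| = (q ^ n.-1 * #|G0|)%N.
  rewrite cardsU (_ : _ :&: _ = set0) ?cards0 ?subn0; last first.
    apply/setP => x; rewrite in_setI in_setD in_set0.
    by apply/negP => /andP[/andP[_ xL] /disj]; rewrite xL.
  rewrite card_lcoset cardsD (setIidPr sHL) subnK ?subset_leq_card //.
  by rewrite LE card_aff_set dW Fq.
split.
(* The first summand yields the indicator of [L], the second that of [kH] minus that of [H]; the
   divisor cancels the factor |W| of [sum_parallel]. *)
- pose c (a b : finvect_type V) : C := (a == 0)%:R * ((b : V) \in W)%:R +
    (if (a : V) \in W then
      (((b : V) - trans k \in W)%:R - ((b : V) \in W)%:R) / (q ^ n.-1)%:R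
    else 0).
  apply: (CL_of_action (c := c)) => // x xG.
  rewrite big_split /= (bigD1 0) //= eqxx mul1r big1 ?addr0; last first.
    by move=> a /negPf->; rewrite mul0r.
  rewrite aff_act_fix0 -big_mkcond /= -mulr_suml sumrB.
  have -> : (x \in M)%:R = (x \in L)%:R +
      ((x \in (k *: H)%g)%:R - (x \in H)%:R) :> C.
    rewrite inE [x \in L :\: H]inE.
    case kHx : (x \in (k *: H)%g).
      have xL := disj _ kHx; rewrite (negPf xL).
      have /negPf-> : x \notin H by apply: contra xL; apply: (subsetP sHL).
      by rewrite orbT subr0 add0r.
    case Hx : (x \in H); last by rewrite orbF subr0 addr0.
    by rewrite (subsetP sHL) //= sub0r subrr.
  have xG0 : lin x \in G0 by move: xG; rewrite mem_aff_set memvf.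
  rewrite kHE HE LE mem_aff_set xG0 andbT; congr (_ + _).
  have [xS|xS] := boolP (lin x \in S).
    have xW : (gl_lfun (lin x) @: W)%VS = W.
      by move: xS; rewrite inE => /andP[_ /eqP].
    rewrite !andbT sum_parallel //.
    (* The subtracted sum is the instance [v = 0]. *)
    have := sum_parallel C 0 xW; under eq_bigr do rewrite subr0.
    rewrite subr0 => ->; rewrite -mulrBr dW Fq [_ * (_ - _)]mulrC mulfK //.
    by rewrite pnatr_eq0 -lt0n expn_gt0 q0.
  rewrite !andbF sum_transverse ?subrr ?mul0r //.
  by apply: contra xS; rewrite inE xG0.
- rewrite /CL_parameter cardM card_aff_set dV Fq.
  have -> : #|finvect_type V| = (q ^ n)%N.
    rewrite -Fq -dV -card_vspace_finvect; apply: eq_card => v.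
    by rewrite !inE memvf.
  rewrite -mulnA [(#|G0| * _)%N]mulnC natrM mulfK // pnatr_eq0 -lt0n.
  by rewrite muln_gt0 expn_gt0 q0 cardG_gt0.
move=> nq; apply: (non_canonical (k := k)) => [|a].
  by rewrite in_setU mem_lcoset mulVg HE group1 /= mem0v orbT.
(* Chosen so that [lin k] maps [trans x - c] to the translation of [k * x]; hence [k * x] lies in
   [L] only if [trans x - c] is in [W]. *)
pose c := (lin k)^-1%g (- trans k).
have cW : c \notin W by rewrite -kSW glKV rpredN.
have [||g [gG0 gS gW]] := @exists_moving_avoiding _ V G0 W a c tr _ dW1 _ cW.
- by rewrite dV.
- by rewrite dV Fq.
pose x : aff V := Aff (a - g a) g.
have xa : aff_act x a = a by rewrite /aff_act /= subrK.
apply/subsetPn; exists (k * x)%g.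
  by rewrite inE aff_actM xa eqxx andbT groupM // inE memvf.
rewrite in_setU mem_lcoset mulKg HE (negPf gS) andbF orbF in_setD.
rewrite HE LE mem_aff_set; apply: contra gW => /and3P[_ /= gW _].
by rewrite -kSW linearB /= glKV opprK addrC.
Qed.
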